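(* Let $k\ge 2$, let $\Delta\ge 13$ be an integer, and let $p_1\geq p_2\geq\cdots\geq p_k\geq 2$ be integers such that $p_1+p_2\geq 14$ and $\sum_{i=1}^k p_i=\Delta-1+k$. Let $H$ be a graph with maximum degree $\Delta(H)=\Delta$ that is a counterexample to the Borodin–Kostochka conjecture, i.e. $\chi(H)>\max\{\omega(H),\Delta(H)-1\}$. Then $H$ is $(K_{p_1},\ldots,K_{p_k})$-partitionable.
   Context: All graphs are finite, simple and undirected. For a graph $H$, $\Delta(H)$ is the maximum degree, $\omega(H)$ the clique number, $\chi(H)$ the chromatic number, and $H[W]$ the subgraph induced by $W\subseteq V(H)$. The Borodin–Kostochka conjecture states that every graph $H$ with $\Delta(H)\ge 9$ satisfies $\chi(H)\le\max\{\omega(H),\Delta(H)-1\}$. A graph $H$ is called $(K_{p_1},\ldots,K_{p_k})$-partitionable if there is a partition of $V(H)$ into $k$ sets $V_1,\ldots,V_k$ such that $\omega(H[V_i])\le p_i-1$ for each $i\in\{1,\ldots,k\}$. *)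

(* Defs.v *)
From mathcomp Require Import all_boot.

Set Implicit Arguments.
Unset Strict Implicit.
Unset Printing Implicit Defensive.

Record sgraph := SGraph {
  vertex :> finType;
  adj : rel vertex;
  adj_sym : symmetric adj;
  adj_irrefl : irreflexive adj
}.

Section Induced.
Variables (G : sgraph) (W : {set G}).

Let iadj : rel {x : G | x \in W} := fun x y => adj (val x) (val y).

Lemma induced_sym : symmetric iadj.
Proof. by move=> x y; apply: adj_sym. Qed.

Lemma induced_irrefl : irreflexive iadj.
Proof. by move=> x; apply: adj_irrefl. Qed.

Definition induced : sgraph := SGraph induced_sym induced_irrefl.

End Induced.

Definition max_degree (G : sgraph) : nat :=
  \max_(x : G) #|[set y | adj x y]|.

Definition clique (G : sgraph) (K : {set G}) : bool :=
  [forall x in K, forall y in K, (x != y) ==> adj x y].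

Definition clique_number (G : sgraph) : nat :=
  \max_(K : {set G} | clique K) #|K|.

Definition colorable (G : sgraph) (n : nat) : bool :=
  [exists c : {ffun G -> 'I_n}, forall x, forall y, adj x y ==> (c x != c y)].

Lemma colorable_exists (G : sgraph) : exists n, colorable G n.
Proof.
exists #|G|; apply/existsP; exists [ffun x => enum_rank x].
apply/forallP=> x; apply/forallP=> y; apply/implyP=> xy; rewrite !ffunE.
by apply/eqP=> /enum_rank_inj exy; move: xy; rewrite exy adj_irrefl.
Qed.

Definition chromatic_number (G : sgraph) : nat := ex_minn (colorable_exists G).

Definition bk_counterexample (G : sgraph) : Prop :=
  9 <= max_degree G /\
  maxn (clique_number G) (max_degree G - 1) < chromatic_number G.

(* Parts may be empty, as with the colour classes of a colouring.  The
   subtraction is truncated, so the bound is the intended one for p i >= 1. *)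
Definition clique_partitionable (G : sgraph) (k : nat) (p : 'I_k -> nat) : Prop :=
  exists V : 'I_k -> {set G},
    [/\ \bigcup_(i < k) V i = [set: G],
        forall i j, i != j -> [disjoint V i & V j] &
        forall i, clique_number (induced (V i)) <= p i - 1].

(* Main.v *)
Require Import Defs.
From mathcomp Require Import all_boot.
From mathcomp Require Import zify.

(** A counterexample [H] satisfies [clique_number H < D]: otherwise Brooks'
    theorem, applied with as many colours as the clique number, would give
    [chromatic_number H <= clique_number H].  From then on colourings are
    irrelevant.  What is shown is that every graph of maximum degree at most
    [D] and clique number at most [D - 1] splits as required.

    The parts are built from independent sets.  Suppose that all degrees are at
    most [m + 1] and all cliques have at most [m] vertices.  If an independent
    set meets every clique of size [m] and is enlarged to a maximal independent
    set, its removal lowers the bound on the degrees by one (maximality) and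
    the bound on the cliques by one (it hits the largest ones); see
    [independent_reduction].  So the step can be repeated.  A union of [q]
    independent sets contains no clique with more than [q] vertices, so
    [p i - 1] successive sets serve as part [i].  After all parts except the
    first are filled, [(D - 1) - (p 0 - 1)] sets have been removed, the degree
    bound is [p 0] and the clique bound is [p 0 - 1]: the remainder is the
    first part.  The step needs [m >= 6], and [p 0 >= 7] follows from
    [p 0 + p 1 >= 14].

    It remains to hit all [m]-cliques by an independent set
    ([independent_hitting_set]).  As the degrees are at most [m + 1], two
    [m]-cliques that meet share at least [m - 2] vertices, so meeting is an
    equivalence relation, and by Hajnal's inequality
    |intersection| + |union| >= 2m the cliques of one class share a core of at
    least [m - 2 >= 4] vertices.  A core vertex has at most two neighbours
    outside a given clique of its class.  Haxell's theorem (parts of size at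
    least twice the maximum degree have an independent transversal) picks one
    vertex from each core, without adjacencies. *)

Set Implicit Arguments.
Unset Strict Implicit.
Unset Printing Implicit Defensive.

(** * Independent transversals *)

Lemma card_bigcup_le (T I : finType) (A : {set I}) (F : I -> {set T}) d :
  (forall i, i \in A -> #|F i| <= d) -> #|\bigcup_(i in A) F i| <= d * #|A|.
Proof.
move=> hF; apply: (@leq_trans (\sum_(i in A) #|F i|)).
  elim/big_rec2: _ => [|i n U _ le_n]; first by rewrite cards0.
  by rewrite (leq_trans (leq_card_setU _ _)) ?leq_add2l.
by rewrite mulnC -sum_nat_const leq_sum.
Qed.

Section Transversal.

Variables (T I : finType) (e : rel T) (c : T -> I).
Hypotheses (e_sym : symmetric e) (e_irr : irreflexive e).

Definition transversal (J : {set I}) (X : {set T}) : Prop :=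
  [/\ c @: X = J, {in X &, injective c} & {in X &, forall x y, ~~ e x y}].

(** Haxell's argument.  A transversal [X] of the parts in [J] is to be extended
    to the part [i0].  Vertices [x_1, x_2, ...] are collected; the blockers of
    [x_i] are its neighbours in [X].  Each [x_i] lies in part [i0] or in a part
    whose vertex of [X] blocks an earlier [x_j], and it is adjacent to nothing
    collected so far (vertices and blockers).  A vertex of part [i0] with no
    blocker completes the transversal.  A vertex of another part with no blocker
    can replace the vertex of [X] in that part, which makes the blockers of some
    [x_j] fewer and keeps those of [x_1, ..., x_(j-1)]; so the sequence of
    numbers of blockers decreases lexicographically.  A vertex with blockers
    makes the collection longer, which happens at most [#|X|] times. *)
Section Augment.

Variables (J : {set I}) (i0 : I) (d : nat).
Hypotheses (i0J : i0 \notin J) (d_gt0 : 0 < d).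
Hypothesis big : forall i, i \in i0 |: J -> 2 * d <= #|[set x | c x == i]|.
Hypothesis deg :
  forall x, c x \in i0 |: J -> #|[set y | e x y]| <= d.

Definition blockers (X : {set T}) x := [set w in X | e x w].

Definition blocked (X : {set T}) (xs : seq T) := [set w in X | has (e^~ w) xs].

Definition reached (X : {set T}) (xs : seq T) := i0 |: c @: blocked X xs.

(** The requirement on the next collected vertex; lists of collected vertices
    have the latest one at their head. *)
Definition candidate (X : {set T}) (xs : seq T) x :=
  [&& c x \in reached X xs, ~~ has (e x) xs & blockers (blocked X xs) x == set0].

Fixpoint valid X xs :=
  if xs is x :: xs' then [&& valid X xs', candidate X xs' x & blockers X x != set0]
  else true.

(** Lexicographic decrease of the numbers of blockers, compared from the oldest
    collected vertex, that is from the end of the list. *)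
Fixpoint improves (xs : seq T) (X X' : {set T}) : Prop :=
  if xs is x :: xs' then
    improves xs' X X' \/
    {in xs', blockers X' =1 blockers X} /\ #|blockers X' x| < #|blockers X x|
  else False.

Lemma blocked_cons X x xs : blocked X (x :: xs) = blockers X x :|: blocked X xs.
Proof. by apply/setP=> w; rewrite !inE /= andb_orr. Qed.

Lemma blocked_sub X xs : blocked X xs \subset X.
Proof. by apply/subsetP=> w; rewrite inE => /andP[]. Qed.

Lemma eq_blocked X X' xs :
  {in xs, blockers X' =1 blockers X} -> blocked X' xs = blocked X xs.
Proof.
elim: xs => [|x xs IH] eqW; first by apply/setP=> w; rewrite !inE !andbF.
rewrite !blocked_cons eqW ?mem_head // IH // => z zxs.
by rewrite eqW // inE zxs orbT.
Qed.

Lemma eq_candidate X X' xs x :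
  {in xs, blockers X' =1 blockers X} -> candidate X' xs x = candidate X xs x.
Proof. by move=> eqW; rewrite /candidate /reached (eq_blocked eqW). Qed.

Lemma eq_valid X X' xs :
  {in xs, blockers X' =1 blockers X} -> valid X' xs = valid X xs.
Proof.
elim: xs => //= x xs IH eqW.
have eqW' : {in xs, blockers X' =1 blockers X}.
  by move=> z zxs; rewrite eqW // inE zxs orbT.
by rewrite IH // (eq_candidate _ eqW') eqW ?mem_head.
Qed.

Lemma candidate_disjoint X xs x :
  candidate X xs x -> #|blocked X (x :: xs)| = #|blockers X x| + #|blocked X xs|.
Proof.
case/and3P=> _ _ /eqP W0; rewrite blocked_cons cardsU.
suff -> : blockers X x :&: blocked X xs = blockers (blocked X xs) x.
  by rewrite W0 cards0 subn0.
by apply/setP=> w; rewrite !inE; case: (w \in X); rewrite // andbC.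
Qed.

(** The blockers of collected vertices form disjoint nonempty sets. *)
Lemma valid_size X xs : valid X xs -> size xs <= #|blocked X xs|.
Proof.
elim: xs => //= x xs IH /and3P[/IH le_xs fx]; rewrite -card_gt0 => W0.
by rewrite candidate_disjoint //; lia.
Qed.

Lemma blocked_reached X xs w : w \in blocked X xs -> c w \in reached X xs.
Proof. by move=> wB; rewrite !inE imset_f ?orbT. Qed.

Lemma reached_cons X x xs : reached X xs \subset reached X (x :: xs).
Proof. by rewrite /reached blocked_cons imsetU setUA setUAC subsetUl. Qed.

Lemma reached_sub X xs : transversal J X -> reached X xs \subset i0 |: J.
Proof. by case=> <- _ _; rewrite setUS ?imsetS ?blocked_sub. Qed.

Lemma valid_reached X xs :
  valid X xs -> {in xs, forall x, c x \in reached X xs}.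
Proof.
elim: xs => //= x xs IH /and3P[/IH IHxs /and3P[fx _ _] _] y.
move=> yxs; apply: (subsetP (reached_cons X x xs)).
by move: yxs; rewrite inE => /predU1P[->|/IHxs].
Qed.

(** With [b] blockers there are at most [b] collected vertices, and these [2b]
    vertices dominate at most [2bd] others, whereas the [b + 1] reached parts
    contain at least [2d(b + 1)] vertices. *)
Lemma candidate_exists X xs :
  transversal J X -> valid X xs -> exists x, candidate X xs x.
Proof.
move=> tX vX; have [cX injc indX] := tX.
have sR := reached_sub xs tX.
set B := blocked X xs; set R := reached X xs.
pose N x := [set y | e x y].
have cardR : #|R| = #|B|.+1.
  rewrite /R /reached cardsU1 card_in_imset; last first.
    by move=> x y xB yB; apply: injc; apply: subsetP (blocked_sub X xs) _ _.
  suff -> : i0 \notin c @: blocked X xs by [].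
  by apply: contra i0J => /(subsetP (imsetS c (blocked_sub X xs))); rewrite cX.
have bigR : 2 * d * #|R| <= #|[set x | c x \in R]|.
  rewrite mulnC -sum_nat_const -sum1_card.
  rewrite (partition_big c (mem R)) => [|x]; last by rewrite inE.
  apply: leq_sum => i iR; rewrite (leq_trans (big (subsetP sR _ iR))) //.
  rewrite -sum1_card; apply: eq_leq; apply: eq_bigl => x; rewrite inE.
  by apply/eqP/andP=> [cx|[_ /eqP//]]; rewrite inE cx eqxx iR.
pose D := \bigcup_(z in [set z in xs] :|: B) N z.
have cardD : #|D| <= d * (2 * #|B|).
  apply: (@leq_trans (d * #|[set z in xs] :|: B|)).
    apply: card_bigcup_le => z; rewrite inE inE => zZ.
    apply: deg; apply: (subsetP sR).
    by case/orP: zZ => [/(valid_reached vX)|/blocked_reached].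
  rewrite leq_mul2l (leq_trans (leq_card_setU _ _)) ?orbT // mul2n -addnn.
  rewrite leq_add2r cardsE (leq_trans (card_size _)) //.
  exact: valid_size.
have /subsetPn[x xR xD] : ~~ ([set x | c x \in R] \subset D).
  apply/negP=> /subset_leq_card; nia.
rewrite inE in xR; exists x; rewrite /candidate xR /=; apply/andP; split.
  apply: contra xD => /hasP[y yxs exy]; apply/bigcupP; exists y.
    by rewrite !inE yxs.
  by rewrite inE e_sym.
apply: contraR xD => /set0Pn[w]; rewrite inE => /andP[wB exw].
by apply/bigcupP; exists w; rewrite inE ?wB ?orbT // e_sym.
Qed.

Lemma swap_transversal X x w :
  transversal J X -> w \in X -> c x = c w -> blockers X x = set0 ->
  transversal J (x |: X :\ w).
Proof.
move=> [cX injc indX] wX cxw W0.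
have nex y : y \in X -> e x y = false.
  by move=> yX; move/setP/(_ y): W0; rewrite !inE yX.
split.
- by rewrite imsetU1 cxw -imsetU1 setD1K.
- move=> y z; rewrite !inE => /predU1P[->|/andP[yw yX]] /predU1P[->|/andP[zw zX]] //.
  + by rewrite cxw => /injc wz; rewrite wz ?eqxx // in zw.
  + by rewrite cxw => /injc wz; rewrite wz ?eqxx // in yw.
  + exact: injc.
- move=> y z; rewrite !inE => /predU1P[->|/andP[yw yX]] /predU1P[->|/andP[zw zX]].
  + by rewrite e_irr.
  + by rewrite nex.
  + by rewrite e_sym nex.
  + exact: indX.
Qed.

(** Only the oldest collected vertex blocked by [w] has to be considered: the
    older ones keep their blockers. *)
Lemma swap_improves X xs x w :
  ~~ has (e x) xs -> w \in blocked X xs -> improves xs X (x |: X :\ w).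
Proof.
elim: xs => [|y xs IH] /=; first by rewrite inE andbF.
rewrite negb_or => /andP[nexy nexs]; rewrite blocked_cons inE orbC.
case wB: (w \in blocked X xs) => /=; first by move=> _; left; apply: IH.
rewrite inE => /andP[wX eyw]; right; split.
  move=> z zxs; apply/setP=> v; rewrite !inE.
  have nzw : e z w = false.
    by move: wB; rewrite inE wX => /negbT/hasPn/(_ z zxs)/negbTE.
  have nzx : e z x = false by rewrite e_sym; apply: negbTE; apply: (hasPn nexs).
  case: (eqVneq v x) => [->|_] /=; first by rewrite nzx andbF.
  by case: (eqVneq v w) => [->|_] //=; rewrite nzw andbF.
apply: proper_card; apply/properP; split.
  apply/subsetP=> v; rewrite !inE; case: (eqVneq v x) => [->|_] /=.
    by rewrite e_sym (negbTE nexy).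
  by case/andP=> /andP[_ ->].
exists w; rewrite !inE ?wX // eqxx /= orbF negb_and.
by case: eqP => //= wx; move: eyw; rewrite wx e_sym (negbTE nexy).
Qed.

(** The outer induction is on the number of vertices of [X] that are not yet
    blockers, the inner one on the number of blockers of the next vertex [x]:
    a recursive call that leaves the older vertices alone has made these
    fewer. *)
Lemma transversal_or_improvement n (X : {set T}) xs :
  #|X| - #|blocked X xs| < n -> transversal J X -> valid X xs ->
  (exists Y, transversal (i0 |: J) Y) \/
  (exists2 X', transversal J X' & improves xs X X').
Proof.
elim: n X xs => // n IHn X xs lt_n tX vX; have [x fx] := candidate_exists tX vX.
have [k le_k] := ubnP #|blockers X x|.
elim: k X le_k lt_n tX vX fx => // k IHk X le_k lt_n tX vX fx.
have [cX injc indX] := tX.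
have [W0|W_neq0] := eqVneq (blockers X x) set0.
  have [xR nexs _] := and3P fx; move: xR; rewrite !inE => /predU1P[cx|].
    left; exists (x |: X).
    have nex y : y \in X -> e x y = false.
      by move=> yX; move/setP/(_ y): W0; rewrite !inE yX.
    have ncx y : y \in X -> c y != i0.
      by move=> yX; apply: contraNneq i0J => <-; rewrite -cX imset_f.
    split.
    - by rewrite imsetU1 cx cX.
    - move=> y z; rewrite !inE => /predU1P[->|yX] /predU1P[->|zX] //.
      + by rewrite cx => /esym/eqP; rewrite (negbTE (ncx _ zX)).
      + by rewrite cx => /eqP; rewrite (negbTE (ncx _ yX)).
      + exact: injc.
    - move=> y z; rewrite !inE => /predU1P[->|yX] /predU1P[->|zX].
      + by rewrite e_irr.
      + by rewrite nex.
      + by rewrite e_sym nex.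
      + exact: indX.
  case/imsetP=> w wB cxw; right; exists (x |: X :\ w).
    by apply: swap_transversal => //; apply: subsetP wB; apply: blocked_sub.
  exact: swap_improves.
have vx : valid X (x :: xs) by rewrite /= vX fx.
have lt_x : #|X| - #|blocked X (x :: xs)| < n.
  have := subset_leq_card (blocked_sub X (x :: xs)).
  by move: W_neq0; rewrite -card_gt0 candidate_disjoint //; lia.
have [|[X' tX' [impr|[eqW lt_W]]]] := IHn _ _ lt_x tX vx; first by left.
  by right; exists X'.
have cardX' : #|X'| = #|X|.
  have [cX' injc' _] := tX'.
  by rewrite -(card_in_imset injc) -(card_in_imset injc') cX cX'.
have [||||||[Y tY impr]] := IHk X' => //; first by lia.
- by rewrite cardX' (eq_blocked eqW).
- by rewrite (eq_valid eqW).
- by rewrite (eq_candidate _ eqW).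
- by left.
right; exists Y => //.
(* X' and X give the same blockers on xs, so Y also improves on X. *)
elim: (xs) eqW impr => //= y ys IH eqW [impr|[eqWY ltY]].
  by left; apply: IH => // z zys; apply: eqW; rewrite inE zys orbT.
right; split; last by rewrite -eqW ?mem_head.
by move=> z zys; rewrite eqWY // eqW // inE zys orbT.
Qed.

Lemma augment X : transversal J X -> exists Y, transversal (i0 |: J) Y.
Proof.
move=> tX; have lt_X : #|X| - #|blocked X [::]| < #|X|.+1.
  by rewrite ltnS leq_subr.
by have [|[]] := transversal_or_improvement lt_X tX isT.
Qed.

End Augment.

(** Haxell's theorem, for the parts given by the fibres of [c] over [J]. *)
Theorem independent_transversal (J : {set I}) d :
  0 < d ->
  (forall i, i \in J -> 2 * d <= #|[set x | c x == i]|) ->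
  (forall x, c x \in J -> #|[set y | e x y]| <= d) ->
  exists X, transversal J X.
Proof.
move=> d_gt0; have [n] := ubnP #|J|; elim: n J => // n IHn J le_n big deg.
have [->|[i iJ]] := set_0Vmem J.
  by exists set0; split; rewrite ?imset0 // => x; rewrite inE.
have [|j|x|X tX] := IHn (J :\ i).
- by move: le_n; rewrite (cardsD1 i) iJ.
- by rewrite inE => /andP[_ /big].
- by rewrite inE => /andP[_ /deg].
rewrite -(setD1K iJ) in big deg *.
by apply: augment d_gt0 big deg _ tX; rewrite !inE eqxx.
Qed.

End Transversal.

(** * Independent sets meeting all largest cliques *)

Section Graph.

Variable G : sgraph.
Implicit Types (S K A B X Y : {set G}) (x y : G).

Definition nbr S x : {set G} := [set y in S | adj x y].

Definition degree_le S d := forall x, x \in S -> #|nbr S x| <= d.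

Definition cliques_le S m :=
  forall K, K \subset S -> clique K -> #|K| <= m.

Definition independent X := {in X &, forall x y, ~~ adj x y}.

Lemma cliqueP K :
  reflect {in K &, forall x y, x != y -> adj x y} (clique K).
Proof.
apply: (iffP forallP) => [cK x y xK yK xy | cK x].
  by move/(_ x)/implyP/(_ xK)/forallP/(_ y): cK => /implyP/(_ yK)/implyP; apply.
apply/implyP=> xK; apply/forallP=> y; apply/implyP=> yK; apply/implyP=> xy.
exact: cK.
Qed.

Lemma clique_sub K A : K \subset A -> clique A -> clique K.
Proof.
move=> /subsetP sKA /cliqueP cA; apply/cliqueP=> x y xK yK.
by apply: cA; apply: sKA.
Qed.

Lemma nbrS S S' x : S \subset S' -> nbr S x \subset nbr S' x.
Proof.
by move=> /subsetP sS; apply/subsetP=> y; rewrite !inE => /andP[/sS-> ->].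
Qed.

Section MaximumCliques.

Variables (S : {set G}) (m : nat).
Hypotheses (degS : degree_le S m.+1) (clS : cliques_le S m) (m_ge6 : 6 <= m).

Definition max_cliques := [set K : {set G} | [&& K \subset S, clique K & #|K| == m]].

Lemma max_cliqueP K : K \in max_cliques -> [/\ K \subset S, clique K & #|K| = m].
Proof. by rewrite inE => /and3P[sKS cK /eqP]. Qed.

(** A common vertex is adjacent to the rest of the union, which therefore has at
    most [m + 2] vertices. *)
Lemma max_clique_meet A B :
  A \in max_cliques -> B \in max_cliques -> A :&: B != set0 -> m - 2 <= #|A :&: B|.
Proof.
move=> /max_cliqueP[sAS /cliqueP cA cardA] /max_cliqueP[sBS /cliqueP cB cardB].
case/set0Pn=> x; rewrite inE => /andP[xA xB].
have: (A :|: B) :\ x \subset nbr S x.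
  apply/subsetP=> y; rewrite !inE eq_sym => /andP[xy /orP[yA|yB]].
    by rewrite (subsetP sAS _ yA) cA.
  by rewrite (subsetP sBS _ yB) cB.
move/subset_leq_card/leq_trans/(_ (degS (subsetP sAS _ xA))).
have := cardsD1 x (A :|: B); rewrite inE xA cardsU cardA cardB /=.
have: #|A :&: B| <= m by rewrite -cardA subset_leq_card ?subsetIl.
lia.
Qed.

(** Two subsets of [B] with [m - 2] vertices each have a common vertex, since
    [m > 4]. *)
Lemma max_clique_meet_trans A B C :
  A \in max_cliques -> B \in max_cliques -> C \in max_cliques ->
  A :&: B != set0 -> B :&: C != set0 -> A :&: C != set0.
Proof.
move=> mA mB mC AB BC; have [_ _ cardB] := max_cliqueP mB.
have := max_clique_meet mA mB AB; have := max_clique_meet mB mC BC.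
have: (A :&: B) :|: (B :&: C) \subset B by rewrite subUset subsetIr subsetIl.
move/subset_leq_card; rewrite cardsU cardB.
have: #|A :&: B :&: (B :&: C)| <= #|A :&: C|.
  by rewrite subset_leq_card // setISS ?subsetIl ?subsetIr.
rewrite -card_gt0; lia.
Qed.

Definition cluster A := [set B in max_cliques | A :&: B != set0].

(** A vertex belongs to the core of the class of [A], i.e. to all its cliques,
    exactly when [cliques_at x = cluster A].  So the cores are fibres of
    [cliques_at]. *)
Definition cliques_at x := [set B in max_cliques | x \in B].

Lemma cluster_eq A B :
  A \in max_cliques -> B \in max_cliques -> A :&: B != set0 ->
  cluster A = cluster B.
Proof.
move=> mA mB AB; apply/setP=> C; rewrite !inE; apply: andb_id2l => mC.
have {}mC : C \in max_cliques by rewrite inE.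
apply/idP/idP; last exact: max_clique_meet_trans.
by apply: max_clique_meet_trans; rewrite // setIC.
Qed.

(** Hajnal's inequality, for a family of cliques meeting [A] which is added one
    clique at a time: [X] is the intersection of the family and [Y] its union.
    The set [X :|: (B :&: Y)] is a clique, hence has at most [m] vertices, and
    this is the inequality for the family with [B] added.  While [X] is
    nonempty, [Y] lies in a closed neighbourhood, so [#|Y| <= m + 2] and
    [#|X| >= m - 2], which keeps [X :&: B] nonempty. *)
Lemma cluster_core_union A (s : seq {set G}) :
  A \in max_cliques -> {subset s <= cluster A} ->
  exists X Y : {set G},
    [/\ X \subset A, {in s, forall B, X \subset B}, A \subset Y & m - 2 <= #|X|] /\
    [/\ Y \subset S, {in X & Y, forall x y, x != y -> adj x y} &
       2 * m <= #|X| + #|Y|].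
Proof.
move=> mA; have [sAS /cliqueP cA cardA] := max_cliqueP mA.
elim: s => [|B s IH] sC.
  by exists A, A; do 2![split=> //]; rewrite ?cardA; lia.
have [|X [Y [[sXA sXs sAY geX] [sYS adjXY geXY]]]] := IH.
  by move=> C Cs; apply: sC; rewrite inE Cs orbT.
have: B \in cluster A by rewrite sC ?mem_head.
rewrite inE => /andP[mB AB]; have [sBS /cliqueP cB cardB] := max_cliqueP mB.
have geAB := max_clique_meet mA mB AB.
have sXY := subset_trans sXA sAY.
have XB_gt0 : 0 < #|X :&: B|.
  have: X :|: (A :&: B) \subset A by rewrite subUset sXA subsetIl.
  move/subset_leq_card; rewrite cardsU cardA setIA (setIidPl sXA).
  by move: geX geAB m_ge6; clear; lia.
have leXBY : #|X| + #|B :&: Y| - #|X :&: B| <= m.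
  have <- : X :&: (B :&: Y) = X :&: B.
    by rewrite setICA (setIidPl sXY) setIC.
  rewrite -cardsU clS //.
    by rewrite subUset (subset_trans sXY) // subIset ?sBS.
  apply/cliqueP=> x y; rewrite !inE.
  case/orP=> [xX|/andP[xB xY]]; case/orP=> [yX|/andP[yB yY]] xy.
  - by rewrite adjXY // (subsetP sXY).
  - by rewrite adjXY.
  - by rewrite adj_sym adjXY // eq_sym.
  - by rewrite cB.
have ge_sum : 2 * m <= #|X :&: B| + #|Y :|: B|.
  rewrite cardsU cardB [Y :&: B]setIC.
  have := subset_leq_card (subsetIl B Y); rewrite cardB.
  by move: (subset_leq_card (subsetIl X B)) leXBY geXY; clear; lia.
have adj' : {in X :&: B & Y :|: B, forall x y, x != y -> adj x y}.
  move=> x y; rewrite !inE => /andP[xX xB] /orP[yY|yB]; first exact: adjXY.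
  exact: cB.
have sY' : Y :|: B \subset S by rewrite subUset sYS.
exists (X :&: B), (Y :|: B); do 2![split=> //].
- by rewrite subIset ?sXA.
- move=> C; rewrite inE => /predU1P[->|Cs]; first exact: subsetIr.
  by rewrite subIset ?sXs.
- by rewrite subsetU ?sAY.
have [x xXB] := card_gt0P XB_gt0.
have xYB : x \in Y :|: B by move: xXB; rewrite !inE => /andP[_ ->]; rewrite orbT.
have: (Y :|: B) :\ x \subset nbr S x.
  apply/subsetP=> y; rewrite 2!inE eq_sym => /andP[xy yYB].
  by rewrite inE (subsetP sY') ?adj'.
move/subset_leq_card/leq_trans/(_ (degS (subsetP sY' _ xYB))).
by have := cardsD1 x (Y :|: B); rewrite xYB; move: ge_sum; clear; lia.
Qed.

Lemma cluster_core A :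
  A \in max_cliques -> m - 2 <= #|[set x | cliques_at x == cluster A]|.
Proof.
move=> mA; have sC : {subset enum (cluster A) <= cluster A}.
  by move=> B; rewrite mem_enum.
have [X [Y [[sXA sXB _ geX] _]]] := cluster_core_union mA sC.
apply: (leq_trans geX); apply/subset_leq_card/subsetP=> x xX; rewrite inE.
apply/eqP/setP=> B; rewrite !inE; apply: andb_id2l => mB.
have {}mB : B \in max_cliques by rewrite inE.
apply/idP/idP=> [xB|AB].
  by apply/set0Pn; exists x; rewrite inE (subsetP sXA).
by apply: (subsetP (sXB B _)) => //; rewrite mem_enum inE mB.
Qed.

(** An independent transversal of the cores, for the graph of those edges that
    lie in no [m]-clique.  An edge inside an [m]-clique cannot join two cores of
    different classes. *)
Lemma independent_hitting_set :
  exists I : {set G}, [/\ I \subset S, independent I &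
                 {in max_cliques, forall K, I :&: K != set0}].
Proof.
pose e x y :=
  [&& adj x y, x \in S, y \in S & cliques_at x :&: cliques_at y == set0].
have e_sym : symmetric e.
  by move=> x y; rewrite /e adj_sym setIC; case: (x \in S); rewrite ?andbF.
have e_irr : irreflexive e by move=> x; rewrite /e adj_irrefl.
pose J := [set cluster A | A in max_cliques].
have clAA A : A \in max_cliques -> A \in cluster A.
  move=> mA; rewrite inE mA setIid -card_gt0.
  by have [_ _ ->] := max_cliqueP mA; apply: leq_trans m_ge6.
have big i : i \in J -> 2 * 2 <= #|[set x | cliques_at x == i]|.
  by case/imsetP=> A /cluster_core geA ->; lia.
have deg x : cliques_at x \in J -> #|[set y | e x y]| <= 2.
  case/imsetP=> A mA cx; have := clAA A mA; rewrite -cx => Ax.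
  move: (Ax); rewrite inE mA /= => xA.
  have [sAS /cliqueP cA cardA] := max_cliqueP mA.
  have: [set y | e x y] :|: A :\ x \subset nbr S x.
    apply/subsetP=> y; rewrite !inE => /orP[/and4P[-> _ -> _] //|/andP[yx yA]].
    by rewrite (subsetP sAS) // cA // eq_sym.
  move/subset_leq_card/leq_trans/(_ (degS (subsetP sAS _ xA))).
  rewrite cardsU; have -> : [set y | e x y] :&: (A :\ x) = set0.
    apply/setP=> y; rewrite !inE; apply/negP.
    case/andP=> /and4P[_ _ _ /eqP/setP/(_ A)] + /andP[_ yA].
    by rewrite in_setI in_set0 Ax in_set mA yA.
  by have := cardsD1 x A; rewrite xA cardA cards0; lia.
have [//|X [cX injX indX]] := independent_transversal e_sym e_irr _ big deg.
have atP x : x \in X -> exists2 A, A \in max_cliques & cliques_at x = cluster A.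
  by move=> xX; apply/imsetP; rewrite -/J -cX imset_f.
have XS x : x \in X -> x \in S.
  case/atP=> A mA cx; have := clAA A mA; rewrite -cx inE => /andP[_ xA].
  by have [/subsetP->] := max_cliqueP mA.
exists X; split.
- by apply/subsetP=> x /XS.
- move=> x y xX yX; have := indX x y xX yX; apply: contra => xy.
  rewrite /e xy !XS //=; apply/negPn/negP=> /set0Pn[B]; rewrite !inE.
  case/andP=> /andP[mB xB] /andP[_ yB].
  suff exy : x = y by rewrite exy adj_irrefl in xy.
  have {}mB : B \in max_cliques by rewrite inE.
  suff at_eq z : z \in X -> z \in B -> cliques_at z = cluster B.
    by apply: injX; rewrite ?at_eq.
  move=> /atP[A mA cz] zB; rewrite cz; apply: cluster_eq => //.
  by have: B \in cluster A; [rewrite -cz inE mB | rewrite inE => /andP[]].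
- move=> K mK; have: cluster K \in cliques_at @: X by rewrite cX imset_f.
  case/imsetP=> x xX cx; have := clAA K mK; rewrite cx inE => /andP[_ xK].
  by apply/set0Pn; exists x; rewrite inE xX.
Qed.

(** A maximal independent set containing a hitting set: by maximality each
    remaining vertex loses a neighbour. *)
Lemma independent_reduction :
  exists I : {set G}, [/\ I \subset S, independent I, degree_le (S :\: I) m &
                 cliques_le (S :\: I) m.-1].
Proof.
have [I0 [sI0S indI0 hitI0]] := independent_hitting_set.
pose P (I : {set G}) :=
  [&& I \subset S, [forall x in I, forall y in I, ~~ adj x y] & I0 \subset I].
have indepP (I : {set G}) :
    reflect (independent I) [forall x in I, forall y in I, ~~ adj x y].
  by apply: (iffP forall_inP) => [h x y /h/forall_inP/[apply]|h x xI];
     last by apply/forall_inP=> y; apply: h.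
have [|I /maxsetP[/and3P[sIS /indepP indI sI0I] maxI] _] := @maxset_exists _ P I0.
  by rewrite /P sI0S subxx andbT; apply/indepP.
exists I; split=> // [x | K].
  rewrite inE => /andP[xI xS].
  have [y yI xy] : exists2 y, y \in I & adj x y.
    apply/exists_inP; apply: contraR xI; rewrite negb_exists_in => /forall_inP nxI.
    rewrite -(maxI (x |: I)) ?setU11 ?subsetUr //.
    rewrite /P subUset sub1set xS sIS /= subsetU ?sI0I ?orbT // andbT.
    apply/indepP=> u v; rewrite !inE => /predU1P[->|uI] /predU1P[->|vI].
    - by rewrite adj_irrefl.
    - exact: nxI.
    - by rewrite adj_sym nxI.
    - exact: indI.
  have : y |: nbr (S :\: I) x \subset nbr S x.
    by rewrite subUset sub1set inE (subsetP sIS) // xy nbrS ?subsetDl.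
  move/subset_leq_card/leq_trans/(_ (degS xS)).
  by rewrite cardsU1 !inE yI.
rewrite subsetD => /andP[sKS dKI] cK.
have le_K := clS sKS cK; suff: #|K| != m by lia.
apply: contraL dKI => cardK; rewrite -setI_eq0.
have: I0 :&: K != set0 by apply: hitI0; rewrite inE sKS cK.
by rewrite setIC; apply: subset_neq0; apply: setIS.
Qed.

End MaximumCliques.

(** A clique has at most one vertex in each of the [q] independent sets whose
    union is [U]. *)
Lemma iterated_reduction q r S :
  6 <= r -> degree_le S (r + q) -> cliques_le S (r + q).-1 ->
  exists U : {set G}, [/\ U \subset S, cliques_le U q, degree_le (S :\: U) r &
                 cliques_le (S :\: U) r.-1].
Proof.
move=> r_ge6; elim: q S => [|q IH] S degS clS.
  exists set0; rewrite addn0 in degS clS; rewrite sub0set setD0; split=> //.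
  by move=> K; rewrite subset0 => /eqP-> _; rewrite cards0.
rewrite addnS /= in degS clS.
have [|I [sIS indI degI clI]] := independent_reduction degS clS; first by lia.
have [U [sUS clU degU clR]] := IH _ degI clI.
exists (I :|: U); rewrite subUset sIS (subset_trans sUS) ?subsetDl //.
rewrite -setDDl; split=> // K sK cK.
rewrite -(cardsID I K) -add1n leq_add //.
  rewrite leqNgt; apply/negP=> /card_gt1P[x [y]].
  rewrite !inE => -[/andP[xK xI] /andP[yK yI] xy].
  by have /negP := indI x y xI yI; apply; move/cliqueP: cK; apply.
apply: clU; last by apply: clique_sub cK; apply: subsetDl.
by rewrite subDset.
Qed.

(** Part [i] of [s] absorbs [q i] independent sets; what is left is part
    [i0]. *)
Lemma clique_partition (I : eqType) (i0 : I) (q : I -> nat) (s : seq I) r S :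
  6 <= r -> uniq (i0 :: s) ->
  degree_le S (r + \sum_(i <- s) q i) ->
  cliques_le S (r + \sum_(i <- s) q i).-1 ->
  exists f : G -> I,
    [/\ {in S, forall x, f x \in i0 :: s},
        {in s, forall i, cliques_le [set x in S | f x == i] (q i)} &
        cliques_le [set x in S | f x == i0] r.-1].
Proof.
move=> r_ge6; elim: s S => [|i s IH] S /= uniq_s.
  rewrite big_nil addn0 => degS clS; exists (fun=> i0); split=> // [x _|].
    by rewrite inE.
  move=> K sK; apply: clS; apply: subset_trans sK _.
  by apply/subsetP=> x; rewrite inE => /andP[].
rewrite big_cons addnCA addnC => degS clS.
have [|U [sUS clU degU clR]] := iterated_reduction _ degS clS; first by lia.
case/and3P: uniq_s => i0_s i_s uniq_s; move: i0_s; rewrite inE negb_or => /andP[i0i i0s].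
have [|f [fS fs f0]] := IH _ _ degU clR; first by rewrite /= i0s.
have restE j : j != i ->
    [set x in S | (if x \in U then i else f x) == j] = [set x in S :\: U | f x == j].
  move=> ji; apply/setP=> x; rewrite !inE; case: ifP => //= _.
  by rewrite eq_sym (negbTE ji) andbF.
exists (fun x => if x \in U then i else f x); split=> [x xS|j|]; last by rewrite restE.
  case: ifP => [_|xU]; first by rewrite !inE eqxx orbT.
  have: f x \in i0 :: s by apply: fS; rewrite inE xU.
  by rewrite !inE => /orP[->|->]; rewrite ?orbT.
rewrite inE => /predU1P[->|js].
  move=> K sK; apply: clU; apply: (subset_trans sK); apply/subsetP=> x.
  rewrite inE => /andP[xS]; case: ifP => // xU /eqP fx.
  have: f x \in i0 :: s by apply: fS; rewrite inE xU.
  by rewrite fx inE eq_sym (negbTE i0i) (negbTE i_s).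
by rewrite restE; [apply: fs | apply: contraNneq i_s => <-].
Qed.

End Graph.

(** * Brooks' theorem *)

Section Brooks.

Variable G : sgraph.
Implicit Types (S P : {set G}) (x y z : G) (s : seq G).

Section Greedy.

Variable d : nat.
Implicit Types f g : G -> 'I_d.

Definition proper_on P f := {in P &, forall x y, adj x y -> f x != f y}.

Lemma proper_onS P P' f : P \subset P' -> proper_on P' f -> proper_on P f.
Proof. by move=> /subsetP sP pf x y /sP xP /sP; apply: pf. Qed.

Lemma proper_extend P f x :
  #|f @: nbr P x| < d -> proper_on P f ->
  exists g, {in P, g =1 f} /\ proper_on (x |: P) g.
Proof.
move=> lt_d pf.
have [xP|xP] := boolP (x \in P).
  by exists f; rewrite (setUidPr _) ?sub1set.
have [a aN] : exists a, a \notin f @: nbr P x.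
  apply/existsP; rewrite -negb_forall; apply: contraL lt_d => /forallP all_in.
  rewrite -leqNgt -[X in X <= _]card_ord; apply/subset_leq_card/subsetP=> a _.
  exact: all_in.
have fa y : y \in P -> adj x y -> a != f y.
  by move=> yP xy; apply: contraNneq aN => ->; rewrite imset_f // inE yP.
have gE : {in P, (fun y => if y == x then a else f y) =1 f}.
  by move=> y yP /=; case: eqP => // yx; rewrite -yx yP in xP.
exists (fun y => if y == x then a else f y); split=> // y z.
rewrite !inE => /predU1P[->|yP] /predU1P[->|zP].
- by rewrite adj_irrefl.
- by rewrite eqxx gE //; apply: fa.
- by rewrite eqxx gE // adj_sym eq_sym; apply: fa.
- by rewrite !gE //; apply: pf.
Qed.

Variable S : {set G}.
Hypothesis degS : degree_le S d.

Lemma extend_uncolored P f x y :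
  P \subset S -> x \in S -> y \in S -> adj x y -> y \notin P -> proper_on P f ->
  exists g, {in P, g =1 f} /\ proper_on (x |: P) g.
Proof.
move=> sPS xS yS xy yP; apply: proper_extend.
apply: (leq_ltn_trans (leq_imset_card _ _)); apply: leq_trans (degS xS).
apply: proper_card; apply/properP; split; first exact: nbrS.
by exists y; rewrite inE ?yS ?xy // (negbTE yP).
Qed.

Lemma extend_repeated P f x u v :
  P \subset S -> x \in S -> u \in nbr P x -> v \in nbr P x -> u != v ->
  f u = f v -> proper_on P f ->
  exists g, {in P, g =1 f} /\ proper_on (x |: P) g.
Proof.
move=> sPS xS uN vN uv fuv; apply: proper_extend.
apply: leq_trans (degS xS).
apply: (@leq_ltn_trans #|nbr P x :\ u|); last first.
  by rewrite (leq_trans _ (subset_leq_card (nbrS _ sPS))) // [ltnRHS](cardsD1 u) uN.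
apply: leq_trans (leq_imset_card f _).
apply/subset_leq_card/subsetP=> _ /imsetP[w wN ->].
have [->|wu] := eqVneq w u; last by rewrite imset_f // in_setD1 wu.
by rewrite fuv imset_f // in_setD1 eq_sym uv.
Qed.

(** Colour the path from its far end towards [z]: each vertex still has an
    uncoloured neighbour, the next one towards [z].  The vertex [z] itself
    remains uncoloured. *)
Lemma greedy_path P f z s :
  P \subset S -> {subset z :: s <= S} -> path (@adj G) z s -> uniq (z :: s) ->
  {in z :: s, forall x, x \notin P} -> proper_on P f ->
  exists g, {in P, g =1 f} /\ proper_on (P :|: [set x in s]) g.
Proof.
elim/last_ind: s P f => [|s y IH] P f sPS sS.
  by move=> _ _ _ pf; exists f; split=> // x u; rewrite !inE !orbF; apply: pf.
have sub x : x \in z :: s -> x \in z :: rcons s y.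
  by rewrite !inE mem_rcons inE => /orP[->|->]; rewrite ?orbT.
have ysz : y \in z :: rcons s y by rewrite inE mem_rcons mem_head orbT.
rewrite -rcons_cons rcons_uniq /= rcons_path.
move=> /andP[pzs adjy] /and3P[yzs zs us] nP pf.
have lS : last z s \in S by apply/sS/sub/mem_last.
have yS : y \in S by apply: sS.
have lP : last z s \notin P by apply/nP/sub/mem_last.
have [|g [gf pg]] := extend_uncolored sPS yS lS _ lP pf; first by rewrite adj_sym.
have [|||||h [hg ph]] := IH (y |: P) g _ _ _ _ _ pg => //.
- by rewrite subUset sub1set yS.
- by move=> x /sub/sS.
- by rewrite /= zs us.
- move=> x xzs; rewrite !inE negb_or nP ?andbT.
    by apply: contraNneq yzs => <-.
  exact: sub.
exists h; split; first by move=> x xP; rewrite hg ?gf // !inE xP orbT.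
have -> // : P :|: [set x in rcons s y] = (y |: P) :|: [set x in s].
by apply/setP=> x; rewrite !inE mem_rcons inE orbCA orbA.
Qed.

(** Same colouring order; [z] can be coloured last because two of its
    neighbours share a colour. *)
Lemma color_path_to P f z s u v :
  P \subset S -> {subset z :: s <= S} -> path (@adj G) z s -> uniq (z :: s) ->
  {in z :: s, forall x, x \notin P} -> proper_on P f ->
  u \in nbr P z -> v \in nbr P z -> u != v -> f u = f v ->
  exists g, {in P, g =1 f} /\ proper_on (P :|: [set x in z :: s]) g.
Proof.
move=> sPS sS pzs uzs nP pf uN vN uv fuv.
have [g [gf pg]] := greedy_path sPS sS pzs uzs nP pf.
move: (uN) (vN); rewrite !inE => /andP[uP zu] /andP[vP zv].
have [||||||h [hg ph]] := @extend_repeated _ g z u v _ _ _ _ _ _ pg => //.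
- rewrite subUset sPS; apply/subsetP=> x; rewrite inE => xs.
  by apply: sS; rewrite inE xs orbT.
- by apply: sS; rewrite mem_head.
- by rewrite !inE uP.
- by rewrite !inE vP.
- by rewrite !gf.
exists h; split; first by move=> x xP; rewrite hg ?gf // !inE xP.
have -> // : P :|: [set x in z :: s] = z |: (P :|: [set x in s]).
by apply/setP=> x; rewrite !inE orbCA.
Qed.

(** Outside the cycle everything is coloured.  Going along the cycle from [y],
    the first vertex [w'] with an outside neighbour [u] follows a vertex [x]
    without any.  Give [x] the colour of [u] and colour the rest of the cycle
    towards [w'], which sees that colour twice. *)
Lemma color_cycle f y s :
  uniq (y :: s) -> cycle (@adj G) (y :: s) -> {subset y :: s <= S} ->
  proper_on (S :\: [set x in y :: s]) f -> nbr (S :\: [set x in y :: s]) y = set0 ->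
  (exists2 w, w \in y :: s & nbr (S :\: [set x in y :: s]) w != set0) ->
  exists g, proper_on S g.
Proof.
set P := S :\: _ => uC cC sC pf y0 [w wC wN].
pose a x := nbr P x != set0.
have [s1 [x [w' [s2 [eqC xN w'N]]]]] :
    exists s1 x w' s2, [/\ y :: s = s1 ++ x :: w' :: s2, nbr P x = set0 &
                          nbr P w' != set0].
  have : has a s.
    apply/hasP; exists w => //; move: wC wN; rewrite inE => /predU1P[->|//].
    by rewrite y0 eqxx.
  elim: (s) (y) y0 => //= z t IH y' y'0.
  have [z0|z0 _] := eqVneq (nbr P z) set0.
    rewrite /a z0 eqxx => /(IH _ z0)[s1 [x [w' [s2 [-> ? ?]]]]].
    by exists (y' :: s1), x, w', s2.
  by exists [::], y', z, t.
(* Cut open between x and w', the cycle is a path that starts at w' and ends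
   at x. *)
have eqrot : rot (size s1).+1 (y :: s) = w' :: s2 ++ rcons s1 x.
  by rewrite eqC -cat_rcons -(size_rcons s1 x) rot_size_cat.
have memC v : (v \in w' :: s2 ++ rcons s1 x) = (v \in y :: s).
  by rewrite -eqrot mem_rot.
move: uC cC; rewrite -(rot_uniq (size s1).+1) -(rot_cycle (size s1).+1) eqrot.
rewrite -rcons_cat -rcons_cons rcons_uniq [cycle _ _]/= rcons_path => /andP[xQ uQ].
rewrite last_rcons rcons_path => /andP[/andP[pQ _] xw'].
move: memC => {eqrot}; rewrite -rcons_cat -rcons_cons.
set Q := s2 ++ s1 in xQ uQ pQ * => memC.
have [u] := set0Pn _ w'N; rewrite 2!inE => /andP[uP w'u].
have [xS w'S] : x \in S /\ w' \in S.
  by split; apply: sC; rewrite -memC mem_rcons !inE ?mem_head ?eqxx ?orbT.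
have xP : x \notin P by rewrite /P in_setD in_set -memC mem_rcons mem_head.
pose g v := if v == x then f u else f v.
have gE : {in P, g =1 f} by move=> v vP; rewrite /g; case: eqP xP => // <-; rewrite vP.
have nxP v : v \in P -> adj x v = false.
  by move=> vP; move/setP/(_ v): xN; rewrite in_set in_set0 vP.
have pg : proper_on (x |: P) g.
  move=> v1 v2; rewrite 2!in_setU1 => /predU1P[->|v1P] /predU1P[->|v2P].
  - by rewrite adj_irrefl.
  - by rewrite nxP.
  - by rewrite adj_sym nxP.
  - by rewrite !gE //; apply: pf.
have sPS : P \subset S by apply: subsetDl.
have [|||||||||h [_ ph]] := @color_path_to _ g w' Q x u _ _ _ _ _ pg => //.
- by rewrite subUset sub1set xS.
- by move=> v vQ; apply: sC; rewrite -memC mem_rcons inE vQ orbT.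
- move=> v vQ; rewrite in_setU1 negb_or /P in_setD in_set -memC mem_rcons inE vQ.
  by rewrite orbT andbT; apply: contraNneq xQ => <-.
- by rewrite in_set setU11 adj_sym.
- by rewrite in_set in_setU1 /P in_setD uP orbT.
- by apply: contraNneq xP => ->; rewrite /P in_setD.
- by rewrite /g eqxx; case: eqP.
exists h; apply: proper_onS ph; apply/subsetP=> v vS.
rewrite in_setU in_setU1 in_set /P in_setD in_set vS andbT -memC mem_rcons inE.
by case: eqP => //= _; rewrite orNb.
Qed.

Lemma maximal_path p :
  p != [::] -> uniq p -> sorted (@adj G) p -> {subset p <= S} ->
  exists h t q, [/\ h :: t = q ++ p, uniq (h :: t), path (@adj G) h t,
    {subset h :: t <= S} & {subset nbr S h <= h :: t}].
Proof.
have [n] := ubnP (#|S| - size p); elim: n p => // n IH [|h t] // le_n _ up pp sp.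
have [sN|] := boolP (nbr S h \subset h :: t).
  by exists h, t, [::]; split=> //; apply/subsetP.
case/subsetPn=> v; rewrite in_set => /andP[vS hv] vp.
have szp : size (v :: h :: t) <= #|S|.
  have uvp : uniq (v :: h :: t) by rewrite cons_uniq vp.
  rewrite -(card_uniqP uvp); apply/subset_leq_card/subsetP=> w.
  by rewrite inE => /predU1P[->|/sp].
have [|||||h' [t' [q [eqp u' p' s' N']]]] := IH (v :: h :: t) => //.
- by move: le_n szp => /=; lia.
- by rewrite cons_uniq vp.
- by rewrite /= adj_sym hv.
- by move=> w; rewrite inE => /predU1P[->|/sp].
by exists h', t', (rcons q v); rewrite cat_rcons.
Qed.

End Greedy.

Lemma split_last (T : Type) (a : pred T) (s : seq T) :
  has a s -> exists (s1 : seq T) (x : T) (s2 : seq T),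
    [/\ s = s1 ++ x :: s2, a x & ~~ has a s2].
Proof.
elim: s => //= x s IH; have [/IH [s1 [y [s2 [-> ay ns2]]]] _|ns] := boolP (has a s).
  by exists (x :: s1), y, s2.
by rewrite orbF => ax; exists [::], x, s.
Qed.

(** Zajac's proof.  In a smallest counterexample all degrees are [d], and some
    [x] has two nonadjacent neighbours [y] and [z].  Extend [y, x, z] to a
    maximal path, ending in [h].  If it covers everything, give [y] and [z] the
    same colour and colour [x] last.  Otherwise the last neighbour of [h] on the
    path closes a cycle outside which [h] has no neighbour: colour the rest by
    induction and then the cycle by [color_cycle], or separately if no edge
    leaves it. *)
Theorem brooks S d :
  2 < d -> degree_le S d -> cliques_le S d ->
  exists f : G -> 'I_d, proper_on S f.
Proof.
move=> d_gt2; have [n] := ubnP #|S|; elim: n S => // n IHn S le_n degS clS.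
have IH S' : S' \proper S -> exists f : G -> 'I_d, proper_on S' f.
  move=> pS'; have sS' := proper_sub pS'; apply: IHn.
  - by have := proper_card pS'; lia.
  - move=> x xS'; apply: leq_trans (degS x (subsetP sS' _ xS')).
    by apply/subset_leq_card/nbrS.
  - by move=> K sK; apply: clS; apply: subset_trans sS'.
have [x /andP[xS lt_x]|regS] := pickP [pred x in S | #|nbr S x| < d].
  have [|f pf] := IH (S :\ x); first by rewrite properD1.
  have [|g [_ pg]] := proper_extend (x := x) _ pf.
    apply: leq_ltn_trans (leq_imset_card _ _) (leq_ltn_trans _ lt_x).
    by apply/subset_leq_card/nbrS/subsetDl.
  by exists g; rewrite setD1K in pg.
have [S0|[x xS]] := set_0Vmem S.
  by exists (fun=> Ordinal (ltnW (ltnW d_gt2))); move=> x y; rewrite S0 inE.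
have degx : #|nbr S x| = d.
  by apply/eqP; rewrite eqn_leq degS // leqNgt; have := regS x; rewrite /= xS /= => ->.
have [y [z [yN zN yz nyz]]] :
    exists y z, [/\ y \in nbr S x, z \in nbr S x, y != z & ~~ adj y z].
  have : ~~ clique (x |: nbr S x).
    have sKS : x |: nbr S x \subset S.
      by rewrite subUset sub1set xS /=; apply/subsetP=> v; rewrite inE => /andP[].
    by apply/negP=> /(clS _ sKS); rewrite cardsU1 degx inE adj_irrefl andbF ltnn.
  rewrite negb_forall_in => /exists_inP[y yK].
  rewrite negb_forall_in => /exists_inP[z zK]; rewrite negb_imply => /andP[yz nyz].
  move: yK zK; rewrite !in_setU1 => /predU1P[eyx|yN] /predU1P[ezx|zN].
  - by rewrite eyx ezx eqxx in yz.
  - by move: zN nyz; rewrite eyx inE => /andP[_ ->].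
  - by move: yN nyz; rewrite ezx inE adj_sym => /andP[_ ->].
  - by exists y, z.
move: (yN) (zN); rewrite !inE => /andP[yS xy] /andP[zS xz].
have yx : y != x by apply: contraTneq xy => ->; rewrite adj_irrefl.
have zx : z != x by apply: contraTneq xz => ->; rewrite adj_irrefl.
have [||||h [t [q [eqp up pp sp Nh]]]] := @maximal_path S [:: z; x; y].
- by [].
- by rewrite /= !inE negb_or zx eq_sym yz eq_sym yx.
- by rewrite /= adj_sym xz xy.
- by move=> v; rewrite !inE => /or3P[]/eqP->.
have [sSp|] := boolP (S \subset h :: t).
  (* Read from h, the path is t1, w, t2, z, x, y, where w is a third neighbour
     of x.  The segment t2 is coloured towards w, then t1 and w towards x. *)
  have [w wN] : exists w, w \in nbr S x :\: [set y; z].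
    apply/card_gt0P; rewrite cardsD degx subn_gt0; apply: leq_ltn_trans d_gt2.
    by rewrite (leq_trans (subset_leq_card (subsetIr _ _))) // cards2 yz.
  move: wN; rewrite !inE negb_or => /and3P[/andP[wy wz] wS xw].
  have wx : w != x by apply: contraTneq xw => ->; rewrite adj_irrefl.
  have wq : w \in q.
    have := subsetP sSp _ wS; rewrite eqp mem_cat !inE.
    by rewrite (negbTE wx) (negbTE wy) (negbTE wz) !orbF.
  have {pp} : sorted (@adj G) (h :: t) by [].
  rewrite {}eqp in up sp sSp *; case/splitPr: wq up sp sSp => t1 t2 up sp sSp pp.
  have pw2 : path (@adj G) w t2.
    move: pp; rewrite -catA => /cat_sorted2[_].
    by rewrite cat_cons /= cat_path => /andP[].
  have pw1 : path (@adj G) w (rev t1).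
    move: pp; rewrite -cat_rcons -catA => /cat_sorted2[] + _.
    by rewrite -rev_sorted rev_rcons /= (eq_path (fun u v => adj_sym v u)).
  pose c0 : 'I_d := Ordinal (ltnW (ltnW d_gt2)).
  have pP : proper_on [set y; z] (fun=> c0).
    move=> u v; rewrite !inE => /orP[]/eqP-> /orP[]/eqP->; rewrite ?adj_irrefl //.
      by rewrite (negbTE nyz).
    by rewrite adj_sym (negbTE nyz).
  have sPS : [set y; z] \subset S by rewrite subUset !sub1set yS.
  move: up; rewrite cat_uniq => /and3P[ut + _].
  rewrite /= !negb_or andbT => /and3P[zA xA yA].
  have nyzA v : v \in t1 ++ w :: t2 -> v \notin [set y; z].
    move=> vA; rewrite !inE negb_or.
    by apply/andP; split; [apply: contraNneq yA | apply: contraNneq zA] => <-.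
  have := ut; rewrite cat_uniq => /and3P[_ _ uwt2].
  have := ut; rewrite -cat_rcons cat_uniq -rev_uniq rev_rcons => /and3P[uwt1 nt12 _].
  have [||g [gf pg]] := greedy_path degS sPS _ pw2 uwt2 _ pP.
  - by move=> v vt; apply: sp; rewrite !mem_cat vt orbT.
  - by move=> v vt; apply: nyzA; rewrite mem_cat vt orbT.
  set P := _ :|: _ in pg.
  have sPS' : P \subset S.
    by rewrite subUset sPS; apply/subsetP=> v; rewrite inE => vt; apply: sp;
       rewrite !mem_cat inE vt !orbT.
  have [||||||||||h' [_ ph]] := @color_path_to _ _ degS P g x (w :: rev t1) y z.
  - by [].
  - move=> v vt; apply: sp; move: vt.
    by rewrite !(inE, mem_cat, mem_rev) => /or3P[]->; rewrite ?orbT.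
  - by rewrite /= xw.
  - rewrite cons_uniq uwt1 andbT; apply: contra xA.
    by rewrite !(inE, mem_cat, mem_rev) => /orP[]->; rewrite ?orbT.
  - move=> v; rewrite inE => /predU1P[->|vt].
      rewrite !inE !negb_or eq_sym yx eq_sym zx /=.
      by apply: contra xA => xt; rewrite mem_cat inE xt !orbT.
    have vr : v \in rcons t1 w by rewrite -mem_rev rev_rcons.
    rewrite in_setU negb_or in_set nyzA; last first.
      by rewrite -cat_rcons mem_cat vr.
    by apply: contra nt12 => vt2; apply/hasP; exists v.
  - by [].
  - by rewrite !inE eqxx xy.
  - by rewrite !inE eqxx orbT xz.
  - by [].
  - by rewrite !gf ?inE ?eqxx ?orbT.
  exists h'; apply: proper_onS ph; apply: subset_trans sSp _.
  apply/subsetP=> v; rewrite !(inE, mem_cat, mem_rev).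
  by case: (v \in t1); case: (v \in t2); case: (v == w); case: (v == x);
     case: (v == y); case: (v == z).
case/subsetPn=> v vS vp.
have [w wN] : exists w, w \in nbr S h.
  apply/card_gt0P; apply: (@leq_trans d); first exact: ltnW (ltnW d_gt2).
  by rewrite leqNgt; have := regS h; rewrite /= sp ?mem_head //= => ->.
have hw : has (adj h) t.
  apply/hasP; exists w; last by move: wN; rewrite inE => /andP[].
  move: (wN) (Nh _ wN); rewrite !inE => /andP[_ hw] /predU1P[wh|//].
  by rewrite wh adj_irrefl in hw.
have [s1 [u [s2 [eqt hu ns2]]]] := split_last hw.
rewrite -cat_rcons in eqt; set C := [set v in h :: rcons s1 u].
have sC : {subset h :: rcons s1 u <= S}.
  by move=> b bC; apply: sp; rewrite eqt -cat_cons mem_cat bC.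
have [f pf] : exists f : G -> 'I_d, proper_on (S :\: C) f.
  apply: IH; apply/properP; split; first exact: subsetDl.
  by exists h; [apply: sC | ]; rewrite ?in_setD ?in_set ?mem_head.
have Nh0 : nbr (S :\: C) h = set0.
  apply/setP=> b; rewrite in_set in_setD in_set0 in_set; apply/negP.
  case/andP=> /andP[bC bS] hb.
  have: b \in h :: t by apply: Nh; rewrite in_set bS.
  rewrite eqt -cat_cons mem_cat (negbTE bC) /= => bs2.
  by move/hasPn/(_ b bs2): ns2; rewrite hb.
have [wC|nC] := pickP [pred w in C | nbr (S :\: C) w != set0].
  rewrite /= in_set => /andP[wC' wN'].
  apply: (color_cycle degS _ _ sC pf Nh0); last by exists wC.
    by move: up; rewrite eqt -cat_cons cat_uniq => /andP[].
  rewrite /= rcons_path last_rcons adj_sym hu andbT.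
  by move: pp; rewrite eqt cat_path => /andP[].
have [f' pf'] : exists f : G -> 'I_d, proper_on C f.
  apply: IH; apply/properP; split; first by apply/subsetP=> b; rewrite in_set => /sC.
  exists v => //; rewrite in_set; apply: contra vp => vC.
  by rewrite eqt -cat_cons mem_cat vC.
have nadj a b : a \in C -> b \in S -> b \notin C -> adj a b = false.
  move=> aC bS bC; have := nC a; rewrite /= aC => /negbFE/eqP/setP/(_ b).
  by rewrite in_set0 in_set in_setD bS bC.
exists (fun b => if b \in C then f' b else f b) => a b aS bS ab.
case: ifP => aC; case: ifP => bC.
- exact: pf'.
- by rewrite nadj ?bC in ab.
- by rewrite adj_sym nadj ?aC in ab.
- by apply: pf; rewrite // in_setD ?aC ?bC.
Qed.

End Brooks.

(** * Partition into clique-bounded parts *)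

Section Invariants.
Variable G : sgraph.

Lemma max_degree_le (S : {set G}) : degree_le S (max_degree G).
Proof.
move=> x _; apply: leq_trans (leq_bigmax x).
by apply/subset_leq_card/subsetP=> y; rewrite !inE => /andP[].
Qed.

Lemma clique_number_le (S : {set G}) : cliques_le S (clique_number G).
Proof. by move=> K _ cK; apply: leq_bigmax_cond. Qed.

Lemma chromatic_number_le d (f : G -> 'I_d) :
  proper_on [set: G] f -> chromatic_number G <= d.
Proof.
move=> pf; rewrite /chromatic_number; case: ex_minnP => n _; apply.
apply/existsP; exists (finfun f); apply/forallP=> x; apply/forallP=> y.
by apply/implyP=> xy; rewrite !ffunE pf.
Qed.

Lemma clique_number_induced (W : {set G}) n :
  cliques_le W n -> clique_number (induced W) <= n.
Proof.
move=> clW; apply/bigmax_leqP=> K /cliqueP cK.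
rewrite -(card_imset _ val_inj) clW //.
  by apply/subsetP=> _ /imsetP[x _ ->]; apply: valP.
apply/cliqueP=> _ _ /imsetP[x xK ->] /imsetP[y yK ->] xy.
by apply: (cK x y) => //; apply: contraNneq xy => ->.
Qed.

End Invariants.

Theorem theorem1 (k : nat) (hk : 2 <= k) (D : nat) (hD : 13 <= D)
    (p : 'I_k -> nat)
    (p_noninc : forall i j : 'I_k, i <= j -> p j <= p i)
    (p_ge2 : forall i : 'I_k, 2 <= p i)
    (p_first2 : 14 <= p (Ordinal (ltnW hk)) + p (Ordinal hk))
    (p_sum : \sum_(i < k) p i = D - 1 + k)
    (H : sgraph) (H_deg : max_degree H = D) (H_bk : bk_counterexample H) :
  clique_partitionable H p.
Proof.
have [_ chi_gt] := H_bk; rewrite gtn_max in chi_gt; case/andP: chi_gt => chi_gt _.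
set w := clique_number H in chi_gt.
have w_lt : w < D.
  rewrite ltnNge; apply/negP=> le_w.
  have [||f pf] := @brooks H [set: H] w _ _ (@clique_number_le _ _).
  - by apply: leq_trans le_w; apply: leq_trans hD.
  - by move=> x xH; apply: leq_trans le_w; rewrite -H_deg max_degree_le.
  by have := chromatic_number_le pf; rewrite leqNgt chi_gt.
set i0 := Ordinal (ltnW hk) in p_first2.
have p0_ge7 : 7 <= p i0.
  by have := p_noninc i0 (Ordinal hk) isT; move: p_first2; lia.
pose s := [seq i <- enum 'I_k | i != i0].
have sum_s : p i0 + \sum_(i <- s) (p i - 1) = D.
  rewrite big_filter big_enum_cond /=.
  have : \sum_(i < k) p i = \sum_(i < k) (p i - 1) + k.
    rewrite -[X in _ = _ + X]card_ord -sum1_card -big_split /=.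
    by apply: eq_bigr => i _; rewrite subnK // ltnW.
  rewrite p_sum (bigD1 i0) //= => /addIn.
  by move: (p i0) (\sum_(i < k | _) _) p0_ge7 hD; lia.
have [||||f [fS fs f0]] :=
    @clique_partition H _ i0 (fun i => p i - 1) s (p i0) [set: H].
- by apply: ltnW.
- by rewrite /= mem_filter eqxx /= filter_uniq // enum_uniq.
- by rewrite sum_s -H_deg; apply: max_degree_le.
- by move=> K sK cK; rewrite sum_s; have := clique_number_le sK cK; rewrite -/w; lia.
exists (fun i => [set x | f x == i]); split.
- by apply/setP=> x; rewrite inE; apply/bigcupP; exists (f x); rewrite ?inE.
- move=> i j ij; rewrite -setI_eq0; apply/eqP/setP=> x; rewrite !inE.
  by case: eqP => // ->; apply: negbTE.
move=> i; apply: clique_number_induced.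
have -> : [set x | f x == i] = [set x in [set: H] | f x == i].
  by apply/setP=> x; rewrite !inE.
have [->|ii0] := eqVneq i i0; first by rewrite subn1.
by apply: fs; rewrite mem_filter ii0 mem_enum.
Qed.
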